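(* Let $X_n\in\mathbb{R}^{n\times p}$ be a column-centered data matrix ($1_n^\top X_n=0_p^\top$) with rows $x_1^\top,\dots,x_n^\top$, let $n>m+p$, and let $\widehat S_n=\frac1n X_n^\top X_n$. For every $\Phi\in\Theta_\Phi$, with $\Sigma(\Phi):=\Phi\Phi^\top$, \begin{align*} \mathcal{L}_n(\Phi):=\min_{Z\in\Theta_Z}\mathcal{L}_n(\Phi,Z) &=\mathrm{tr}(\widehat S_n)+\mathrm{tr}(\Phi\Phi^\top)-2\,\mathrm{tr}\left\{(\Phi^\top\widehat S_n\Phi)^{1/2}\right\}\\ &=\mathrm{tr}(\widehat S_n)+\mathrm{tr}\{\Sigma(\Phi)\}-2\,\mathrm{tr}\left\{\left(\widehat S_n^{1/2}\Sigma(\Phi)\widehat S_n^{1/2}\right)^{1/2}\right\} = d_{\mathrm{BW}}^2\left(\widehat S_n,\Sigma(\Phi)\right). \end{align*}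
   Context: Let $p,m,n$ be positive integers with $m<p$. Fix constants $c_\Lambda>0$ and $0<c_L\le c_U$. Define $\Theta_\Lambda=\{\Lambda=(\lambda_{jk})\in\mathbb{R}^{p\times m}: |\lambda_{jk}|\le c_\Lambda \text{ for all } j,k\}$, $\Theta_\Psi=\{\mathrm{diag}(\sigma_1,\dots,\sigma_p): c_L\le|\sigma_j|\le c_U \text{ for all } j\}$, and $\Theta_\Phi=\{\Phi=[\Lambda,\Psi]\in\mathbb{R}^{p\times(m+p)}:\Lambda\in\Theta_\Lambda,\ \Psi\in\Theta_\Psi\}$. Let $\Theta_Z$ be the set of all $Z=[F,E]\in\mathbb{R}^{n\times(m+p)}$, $F\in\mathbb{R}^{n\times m}$, $E\in\mathbb{R}^{n\times p}$, with $1_n^\top F=0_m^\top$, $1_n^\top E=0_p^\top$, $\frac1nF^\top F=I_m$, $\frac1nE^\top E=I_p$, $F^\top E=O_{m\times p}$ (where $1_n$ is the vector of ones, and $0_m$, $O_{m\times p}$ denote a zero vector and a zero matrix). The matrix decomposition factor analysis (MDFA) loss is, for $\Phi=[\Lambda,\Psi]$ and $Z=[F,E]$, $$\mathcal{L}_n(\Phi,Z)=\frac1n\left\|X_n-(F\Lambda^\top+E\Psi)\right\|_F^2 = \frac1n\left\|X_n-Z\Phi^\top\right\|_F^2 .$$ For a positive semidefinite matrix $A$, $A^{1/2}$ is its positive semidefinite square root. For positive semidefinite $p\times p$ matrices $A,B$, the Bures-Wasserstein distance $d_{\mathrm{BW}}(A,B)\ge 0$ is given by $d_{\mathrm{BW}}^2(A,B)=\mathrm{tr}(A)+\mathrm{tr}(B)-2\,\mathrm{tr}\{(A^{1/2}BA^{1/2})^{1/2}\}$.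 *)

(* Defs.v *)
From mathcomp Require Import all_boot all_order all_algebra.
From mathcomp Require Import boolp classical_sets reals.

Set Implicit Arguments.
Unset Strict Implicit.
Unset Printing Implicit Defensive.

Import Order.TTheory GRing.Theory Num.Theory.

Local Open Scope classical_set_scope.
Local Open Scope ring_scope.

Definition psdmx (R : realType) (k : nat) (A : 'M[R]_k) : Prop :=
  A^T = A /\ forall x : 'cV[R]_k, 0 <= (x^T *m A *m x) 0 0.

(* Every psd matrix has exactly one psd square root; the default value 0 is
   only taken when A is not psd. *)
Definition psdsqrtmx (R : realType) (k : nat) (A : 'M[R]_k) : 'M[R]_k :=
  xget 0 [set B | psdmx B /\ B *m B = A].

(* [`|A|] would be the max norm of MathComp-Analysis. *)
Definition frobnorm (R : realType) (k l : nat) (A : 'M[R]_(k, l)) : R :=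
  Num.sqrt (\sum_i \sum_j A i j ^+ 2).

Definition dBW (R : realType) (k : nat) (A B : 'M[R]_k) : R :=
  Num.sqrt (\tr A + \tr B
            - 2 * \tr (psdsqrtmx (psdsqrtmx A *m B *m psdsqrtmx A))).

Definition ThetaLambda (R : realType) (p m : nat) (cLambda : R) :
    set 'M[R]_(p, m) :=
  [set Lambda | forall j k, `|Lambda j k| <= cLambda].

Definition ThetaPsi (R : realType) (p : nat) (cL cU : R) : set 'M[R]_p :=
  [set diag_mx s | s in [set s : 'rV[R]_p | forall j, cL <= `|s 0 j| <= cU]].

Definition ThetaPhi (R : realType) (p m : nat) (cLambda cL cU : R) :
    set 'M[R]_(p, m + p) :=
  [set row_mx Lambda Psi | Lambda in ThetaLambda cLambda
                         & Psi in ThetaPsi cL cU].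

Definition ThetaZ (R : realType) (n m p : nat) : set 'M[R]_(n, m + p) :=
  [set Z | exists (F : 'M[R]_(n, m)) (E : 'M[R]_(n, p)),
    Z = row_mx F E /\
    [/\ (const_mx 1 : 'cV[R]_n)^T *m F = 0,
        (const_mx 1 : 'cV[R]_n)^T *m E = 0,
        n%:R^-1 *: (F^T *m F) = 1%:M,
        n%:R^-1 *: (E^T *m E) = 1%:M
      & F^T *m E = 0]].

Definition mdfa_loss (R : realType) (n m p : nat) (X : 'M[R]_(n, p))
    (Phi : 'M[R]_(p, m + p)) (Z : 'M[R]_(n, m + p)) : R :=
  n%:R^-1 * frobnorm (X - Z *m Phi^T) ^+ 2.

Lemma mdfa_loss_row_mx (R : realType) (n m p : nat) (X : 'M[R]_(n, p))
    (Lambda : 'M[R]_(p, m)) (s : 'rV[R]_p)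
    (F : 'M[R]_(n, m)) (E : 'M[R]_(n, p)) :
  mdfa_loss X (row_mx Lambda (diag_mx s)) (row_mx F E) =
  n%:R^-1 * frobnorm (X - (F *m Lambda^T + E *m diag_mx s)) ^+ 2.
Proof. by rewrite /mdfa_loss tr_row_mx mul_row_col tr_diag_mx. Qed.

Definition mdfa_losses (R : realType) (n m p : nat) (X : 'M[R]_(n, p))
    (Phi : 'M[R]_(p, m + p)) : set R :=
  [set mdfa_loss X Phi Z | Z in @ThetaZ R n m p].

(* That this infimum is attained is part of the theorem. *)
Definition mdfa_min_loss (R : realType) (n m p : nat) (X : 'M[R]_(n, p))
    (Phi : 'M[R]_(p, m + p)) : R :=
  inf (mdfa_losses X Phi).

Definition sample_cov (R : realType) (n p : nat) (X : 'M[R]_(n, p)) : 'M[R]_p :=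
  n%:R^-1 *: (X^T *m X).

Definition Sigma (R : realType) (p k : nat) (Phi : 'M[R]_(p, k)) : 'M[R]_p :=
  Phi *m Phi^T.

(* Main.v *)
(* Since Z^T Z = n I, the loss is tr S + tr (Phi Phi^T) - (2/n) tr (Z^T X Phi).  With
   Y = X Phi / sqrt n and B = (Y^T Y)^(1/2) = (Phi^T S Phi)^(1/2), diagonalise
   B = Q^T diag(d) Q.  The i-th columns of Z Q^T / sqrt n and of Y Q^T have norms 1
   and d_i, so Cauchy-Schwarz gives tr (Z^T Y) <= sqrt n * tr B.  Equality is reached
   by normalising the nonzero columns of Y Q^T and completing them to an orthonormal
   family in the orthogonal complement of 1_n, which is possible because n > m + p.
   The second formula holds because C^T C and C C^T, for C = S^(1/2) Phi, have square
   roots of equal trace. *)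

Require Import Defs.
From mathcomp Require Import all_boot all_order all_algebra.
From mathcomp Require Import boolp classical_sets reals.
From mathcomp Require Import complex ring lra.

Set Implicit Arguments.
Unset Strict Implicit.
Unset Printing Implicit Defensive.

Import Order.TTheory GRing.Theory Num.Theory.

Local Open Scope classical_set_scope.
Local Open Scope ring_scope.

(** * Inner products of rows and orthonormal completion *)

Lemma mulmx_row_trmx (R : comNzRingType) (k l n : nat)
    (A : 'M[R]_(k, n)) (B : 'M[R]_(l, n)) i j :
  (A *m B^T) i j = (row i A *m (row j B)^T) 0 0.
Proof. by rewrite !mxE; apply: eq_bigr => s _; rewrite !mxE. Qed.

Lemma row_sqrnorm_ge0 (R : realDomainType) (n : nat) (v : 'rV[R]_n) :
  0 <= (v *m v^T) 0 0.
Proof. by rewrite mxE sumr_ge0// => i _; rewrite mxE -expr2 sqr_ge0. Qed.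

Lemma row_sqrnorm_eq0 (R : realDomainType) (n : nat) (v : 'rV[R]_n) :
  ((v *m v^T) 0 0 == 0) = (v == 0).
Proof.
apply/eqP/eqP => [|->]; last by rewrite mul0mx mxE.
rewrite mxE => /eqP; rewrite psumr_eq0 => [/allP v0|i _]; last first.
  by rewrite mxE -expr2 sqr_ge0.
apply/rowP => i; have := v0 i; rewrite mem_index_enum !mxE => /(_ isT).
by rewrite mulf_eq0 orbb => /eqP.
Qed.

Lemma mulmx_tr_eq0 (R : realDomainType) (k n : nat) (A : 'M[R]_(k, n)) :
  A *m A^T = 0 -> A = 0.
Proof.
move=> AA; apply/row_matrixP => i; rewrite row0; apply/eqP.
by rewrite -row_sqrnorm_eq0 -mulmx_row_trmx AA mxE.
Qed.

(** The unit vector is given as a multiple of [v], so that orthogonality relations and eigenvector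
    equations carry over to it. *)
Lemma row_normalize (R : rcfType) (n : nat) (v : 'rV[R]_n) :
  v != 0 -> exists2 a : R, a != 0 & (a *: v) *m (a *: v)^T = 1%:M.
Proof.
move=> v0; have q0 : 0 < (v *m v^T) 0 0.
  by rewrite lt_def row_sqrnorm_eq0 v0 row_sqrnorm_ge0.
exists (Num.sqrt ((v *m v^T) 0 0))^-1; first by rewrite invr_eq0 gt_eqF ?sqrtr_gt0.
rewrite linearZ /= -scalemxAl -scalemxAr scalerA -invfM -expr2 sqr_sqrtr ?ltW//.
apply/matrixP => i j; rewrite !ord1 mxE [RHS]mxE eqxx mulVf //.
by rewrite gt_eqF.
Qed.

(** Induction on the number of rows outside [P]: one of them is replaced by a unit vector orthogonal
    to [e] and to the rows in [P], and its index joins [P]. *)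
Lemma orthonormal_completion (R : rcfType) (k n : nat) (e : 'rV[R]_n)
    (P : {set 'I_k}) (W : 'M[R]_(k, n)) :
  (k < n)%N ->
  (forall i, i \in P -> (W *m e^T) i 0 = 0) ->
  {in P &, forall i j, (W *m W^T) i j = (i == j)%:R} ->
  exists V : 'M[R]_(k, n),
    [/\ V *m V^T = 1%:M, V *m e^T = 0 & {in P, forall i, row i V = row i W}].
Proof.
move=> ltkn; move cP : #|~: P| => c.
elim: c P W cP => [|c IHc] P W cP We WW.
  have inP i : i \in P.
    by move/eqP: cP; rewrite cards_eq0 => /eqP/finset.setP/(_ i); rewrite !inE => /negbFE.
  exists W; split=> //; first by apply/matrixP => i j; rewrite WW ?inP // !mxE.
  by apply/matrixP => i j; rewrite ord1 We ?inP // mxE.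
have /card_gt0P[i0] : (0 < #|~: P|)%N by rewrite cP.
rewrite inE => i0P.
(* [e] takes the place of the missing row [i0], so that [k < n] constraints suffice. *)
pose M := \matrix_(i < k) if i \in P then row i W else if i == i0 then e else 0.
have /rowV0Pn[v /sub_kermxP vM v0] : kermx M^T != 0.
  rewrite -mxrank_eq0 mxrank_ker mxrank_tr -lt0n subn_gt0.
  by rewrite (leq_ltn_trans _ ltkn) ?rank_leq_row.
have vMi i : row i M *m v^T = 0.
  by rewrite -[row i M]trmxK -trmx_mul tr_row colE mulmxA vM mul0mx trmx0.
have [a a0 vv] := row_normalize v0.
set u := a *: v in vv.
pose W' := \matrix_(i < k) if i == i0 then u else row i W.
have W'i i : row i W' = if i == i0 then u else row i W by rewrite rowK.
have P0 i : i \in P -> (i == i0) = false by move=> iP; apply: contraNF i0P => /eqP <-.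
have Wu i : i \in P -> row i W *m u^T = 0.
  by move=> iP; have := vMi i;
    rewrite rowK iP linearZ /= -scalemxAr => ->; rewrite scaler0.
have eu : e *m u^T = 0.
  have := vMi i0; rewrite rowK (negbTE i0P) eqxx linearZ /= -scalemxAr => ->.
  by rewrite scaler0.
have [|||V [VV Ve VW]] := IHc (i0 |: P) W'.
- have -> : ~: (i0 |: P) = ~: P :\ i0.
    by apply/finset.setP => x; rewrite !inE negb_or.
  by move: cP; rewrite (cardsD1 i0) inE i0P => -[].
- move=> i; rewrite in_setU1 mulmx_row_trmx W'i => /orP[/eqP->|iP].
    by rewrite eqxx -[_ *m _]trmxK trmx_mul trmxK row_id eu trmx0 mxE.
  by rewrite P0 // -mulmx_row_trmx We.
- move=> i j; rewrite !in_setU1 !(mulmx_row_trmx W') !W'i.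
  case: (i =P i0) => [->|_] /=; case: (j =P i0) => [->|_] //=.
  + by rewrite vv !mxE !eqxx.
  + move=> _ jP; rewrite -[_ *m _]trmxK trmx_mul trmxK Wu // trmx0 mxE.
    by rewrite eq_sym P0.
  + by move=> iP _; rewrite Wu // mxE P0.
  + by move=> iP jP; rewrite -mulmx_row_trmx WW.
exists V; split=> // i iP; rewrite VW ?in_setU1 ?iP ?orbT // W'i P0 //.
Qed.

(** * Spectral theorem for real symmetric matrices *)

(** An eigenvalue exists over the algebraically closed [R[i]]. It is real because the matrix is
    Hermitian there, and it is then a root of the characteristic polynomial over [R]. *)
Lemma sym_eigenvalue (R : rcfType) (n : nat) (A : 'M[R]_n) :
  (0 < n)%N -> A^T = A -> exists a, eigenvalue A a.
Proof.
move=> n0 symA; pose f := real_complex R.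
have [a ea] := eigenvalue_closed (map_mx f A) n0.
have [v vA v0] := eigenvalueP ea.
have [r ar] : exists r, a = f r.
  apply/complex_realP/CrealP.
  have cA : map_mx Num.conj (map_mx f A)^T = map_mx f A.
    by rewrite map_trmx symA; apply/matrixP => i j; rewrite !mxE; exact: conjc_real.
  pose w : 'cV_n := map_mx Num.conj v^T.
  (* With [w] the conjugate transpose of [v], the product [v A w] is evaluated from the left and
     from the right; [v *m w] is a sum of squared moduli, hence nonzero and cancellable. *)
  have /matrixP/(_ 0 0) : a^* *: (v *m w) = a *: (v *m w).
    rewrite scalemxAl -vA -mulmxA scalemxAr -map_mxZ -linearZ /= -vA trmx_mul.
    by rewrite map_mxM cA.
  rewrite mxE [RHS]mxE; apply: mulIf.
  rewrite mxE psumr_eq0 => [|i _]; last by rewrite !mxE mul_conjC_ge0.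
  apply: contraNN v0 => /allP v0; apply/eqP/rowP => i.
  have := v0 i; rewrite mem_index_enum => /(_ isT).
  by rewrite !mxE mul_conjC_eq0 => /eqP.
exists r; move: ea; rewrite !eigenvalue_root_char ar -map_char_poly.
by rewrite fmorph_root.
Qed.

(** Induction on the size: a unit eigenvector [v] is completed to an orthonormal basis, in which [A]
    is block diagonal with the symmetric block [W A W^T]. *)
Lemma spectral_sym (R : rcfType) (n : nat) (A : 'M[R]_n) :
  A^T = A -> exists (Q : 'M[R]_n) (d : 'rV[R]_n),
    Q *m Q^T = 1%:M /\ A = Q^T *m diag_mx d *m Q.
Proof.
elim: n A => [|n IHn]; last rewrite -[n.+1]add1n; move=> A symA.
  by exists 1%:M, 0; rewrite trmx1 mulmx1 mul1mx; split=> //; apply/matrixP => -[].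
have [a /eigenvalueP[v0 v0A v0N0]] := sym_eigenvalue (ltn0Sn n) symA.
have [v vv vA] : exists2 v : 'rV_(1 + n), v *m v^T = 1%:M & v *m A = a *: v.
  have [b _ vv] := row_normalize v0N0; exists (b *: v0) => //.
  by rewrite -scalemxAl v0A !scalerA mulrC.
(* No row is prescribed: all [n] rows are created, orthogonal to [v] in dimension [n + 1]. *)
have [||W [WW Wv _]] := @orthonormal_completion _ n (1 + n) v finset.set0 0 (ltnSn n).
- by move=> i; rewrite inE.
- by move=> i j; rewrite inE.
have [|Q [d [QQ WAW]]] := IHn (W *m A *m W^T).
  by rewrite !trmx_mul trmxK symA mulmxA.
pose U : 'M[R]_(1 + n) := col_mx v W.
have vW : v *m W^T = 0 by rewrite -[v]trmxK -trmx_mul Wv trmx0.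
have UU : U *m U^T = 1%:M.
  by rewrite tr_col_mx mul_col_row vv WW vW Wv -scalar_mx_block.
have UU' : U^T *m U = 1%:M by apply: mulmx1C.
have AvT : A *m v^T = a *: v^T by rewrite -[A]symA -trmx_mul vA linearZ.
have UAU : U *m A *m U^T = block_mx a%:M 0 0 (Q^T *m diag_mx d *m Q).
  rewrite /U tr_col_mx mul_col_mx mul_col_row -WAW vA -!scalemxAl vv vW.
  by rewrite -mulmxA AvT -scalemxAr Wv !scaler0 scalemx1.
pose P : 'M[R]_(1 + n) := block_mx 1%:M 0 0 Q.
exists (P *m U), (row_mx a%:M d : 'rV_(1 + n)); split.
  rewrite trmx_mul mulmxA -(mulmxA P) UU mulmx1 tr_block_mx mulmx_block.
  by rewrite !trmx1 !trmx0 QQ !(mulmx0, mul0mx, addr0, add0r, mulmx1) -scalar_mx_block.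
have -> : A = U^T *m (U *m A *m U^T) *m U.
  by rewrite !mulmxA UU' mul1mx -mulmxA UU' mulmx1.
rewrite UAU trmx_mul !mulmxA; congr (_ *m U); rewrite -!mulmxA; congr (_ *m _).
rewrite diag_mx_row tr_block_mx !mulmx_block !trmx1 !trmx0.
rewrite !(mulmx0, mul0mx, addr0, add0r, mulmx1, mul1mx) mulmxA; congr block_mx.
by apply/matrixP => i j; rewrite !ord1 !mxE.
Qed.

(** * Positive semidefinite matrices and their square roots *)

Lemma psdmx_congr (R : realType) (k l : nat) (A : 'M[R]_k) (C : 'M[R]_(k, l)) :
  psdmx A -> psdmx (C^T *m A *m C).
Proof.
move=> [symA A0]; split; first by rewrite !trmx_mul trmxK symA mulmxA.
by move=> x; have := A0 (C *m x); rewrite trmx_mul !mulmxA.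
Qed.

Lemma psdmx_diag (R : realType) (k : nat) (d : 'rV[R]_k) :
  (forall i, 0 <= d 0 i) -> psdmx (diag_mx d).
Proof.
move=> d0; split; first exact: tr_diag_mx.
move=> x; rewrite mul_mx_diag mxE sumr_ge0 // => i _.
by rewrite !mxE mulrAC -expr2 mulr_ge0 ?sqr_ge0.
Qed.

Lemma psdmx_gram (R : realType) (k l : nat) (C : 'M[R]_(k, l)) :
  psdmx (C^T *m C).
Proof.
rewrite -[C^T]mulmx1; apply: psdmx_congr; rewrite -diag_const_mx.
by apply: psdmx_diag => i; rewrite mxE.
Qed.

Lemma psdmx_spectral (R : realType) (k : nat) (A : 'M[R]_k) : psdmx A ->
  exists (Q : 'M[R]_k) (d : 'rV[R]_k),
    [/\ Q *m Q^T = 1%:M, forall i, 0 <= d 0 i & A = Q^T *m diag_mx d *m Q].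
Proof.
move=> [symA A0]; have [Q [d [QQ AE]]] := spectral_sym symA.
exists Q, d; split=> // i.
(* The quadratic form of [A] at its [i]-th eigenvector equals [d 0 i]. *)
have := A0 (row i Q)^T; have -> : (row i Q)^T = Q^T *m delta_mx i 0.
  by rewrite -colE tr_row.
rewrite AE trmx_mul trmxK !mulmxA -(mulmxA _ Q) QQ mulmx1 -(mulmxA _ Q) QQ mulmx1.
rewrite trmx_delta mul_mx_diag mxE (bigD1 i) //= big1 => [|j /negbTE ji].
  by rewrite !mxE !eqxx mul1r mulr1 addr0.
by rewrite !mxE ji !(mul0r, mulr0).
Qed.

Lemma psdmx_sqrt_exists (R : realType) (k : nat) (A : 'M[R]_k) :
  psdmx A -> exists B, psdmx B /\ B *m B = A.
Proof.
move=> /psdmx_spectral[Q [d [QQ d0 ->]]].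
pose s := map_mx Num.sqrt d.
exists (Q^T *m diag_mx s *m Q); split.
  by apply/psdmx_congr/psdmx_diag => i; rewrite mxE sqrtr_ge0.
rewrite !mulmxA -(mulmxA _ Q) QQ mulmx1 -(mulmxA Q^T) mulmx_diag.
congr (_ *m diag_mx _ *m _); apply/rowP => i.
by rewrite !mxE -expr2 sqr_sqrtr.
Qed.

(** Let [W] be the change of basis between eigenbases of [A] and [B]. Equality of the squares reads
    [(a_i^2 - b_j^2) W_ij = 0], and nonnegativity reduces this to [(a_i - b_j) W_ij = 0], that is,
    [A = B]. *)
Lemma psdmx_sqrt_uniq (R : realType) (k : nat) (A B : 'M[R]_k) :
  psdmx A -> psdmx B -> A *m A = B *m B -> A = B.
Proof.
move=> /psdmx_spectral[Q [a [QQ a0 ->]]] /psdmx_spectral[P [b [PP b0 ->]]].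
have QQ' := mulmx1C QQ; have PP' := mulmx1C PP.
rewrite !mulmxA -(mulmxA _ Q) QQ mulmx1 -(mulmxA _ P) PP mulmx1 => E.
pose W := Q *m P^T.
have E2 : diag_mx a *m diag_mx a *m W = W *m diag_mx b *m diag_mx b.
  transitivity (Q *m (Q^T *m diag_mx a *m diag_mx a *m Q) *m P^T).
    by rewrite !mulmxA QQ mul1mx.
  by rewrite E !mulmxA -(mulmxA _ P) PP mulmx1.
suff E1 : diag_mx a *m W = W *m diag_mx b.
  rewrite -[RHS]mul1mx -QQ' -!mulmxA (mulmxA Q) -/W (mulmxA W) -E1.
  by rewrite -!mulmxA PP' mulmx1.
move: {E} W E2 => W; rewrite -mulmxA !mul_diag_mx !mul_mx_diag => /matrixP E2.
apply/matrixP => i j; move: (E2 i j); rewrite !mxE => Eij.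
have /eqP : (a 0 i + b 0 j) * (a 0 i * W i j - W i j * b 0 j) = 0.
  by transitivity (a 0 i * (a 0 i * W i j) - W i j * b 0 j * b 0 j);
    [ring|rewrite Eij subrr].
(* If [a_i + b_j = 0], both terms vanish by nonnegativity, and so do both sides of the goal. *)
rewrite mulf_eq0 paddr_eq0 // => /orP[/andP[/eqP-> /eqP->]|].
  by rewrite mul0r mulr0.
by rewrite subr_eq0 => /eqP.
Qed.

Lemma psdsqrtmxP (R : realType) (k : nat) (A : 'M[R]_k) : psdmx A ->
  psdmx (psdsqrtmx A) /\ psdsqrtmx A *m psdsqrtmx A = A.
Proof.
move=> /psdmx_sqrt_exists[B BA]; rewrite /psdsqrtmx.
exact: (@xgetPex _ 0 [set B | psdmx B /\ B *m B = A]) (ex_intro _ B BA).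
Qed.

Lemma psdsqrtmx_eq (R : realType) (k : nat) (B : 'M[R]_k) :
  psdmx B -> psdsqrtmx (B *m B) = B.
Proof.
move=> Bpsd; have symB := Bpsd.1.
have [|Spsd SS] := @psdsqrtmxP _ _ (B *m B).
  by rewrite -{1}symB; exact: psdmx_gram.
exact: psdmx_sqrt_uniq.
Qed.

(* With [P] the pseudo-inverse of [B = (C^T C)^(1/2)], the square root of [C C^T]
   is [C P C^T], whose trace is [tr (P B^2) = tr B]. *)
Lemma mxtrace_psdsqrt_gram_tr (R : realType) (k l : nat) (C : 'M[R]_(k, l)) :
  \tr (psdsqrtmx (C^T *m C)) = \tr (psdsqrtmx (C *m C^T)).
Proof.
have [] := psdsqrtmxP (psdmx_gram C); set B := psdsqrtmx _.
move=> Bpsd BB; have [Q [d [QQ d0 BE]]] := psdmx_spectral Bpsd.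
have QQ' := mulmx1C QQ.
(* Since the inverse of 0 is 0, zero eigenvalues stay zero, and [P] below is the pseudo-inverse of
   [B]. *)
pose e : 'rV[R]_l := map_mx GRing.inv d.
pose P := Q^T *m diag_mx e *m Q.
have Ppsd : psdmx P by apply/psdmx_congr/psdmx_diag => i; rewrite mxE invr_ge0.
have QK (x y : 'rV[R]_l) : Q^T *m diag_mx x *m Q *m (Q^T *m diag_mx y *m Q)
    = Q^T *m diag_mx (\row_i (x 0 i * y 0 i)) *m Q.
  by rewrite !mulmxA -(mulmxA _ Q) QQ mulmx1 -(mulmxA Q^T) mulmx_diag.
have ede : \row_i ((\row_j (d 0 j * e 0 j)) 0 i * d 0 i) = d.
  apply/rowP => i; rewrite !mxE; have [->|di] := eqVneq (d 0 i) 0.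
    by rewrite mulr0.
  by rewrite divff ?mul1r.
have BPB : B *m P *m B = B by rewrite BE !QK ede.
have PB : P *m B = B *m P.
  by rewrite BE !QK; congr (_ *m diag_mx _ *m _); apply/rowP => i; rewrite !mxE mulrC.
clearbody P.
(* The difference [D = C (P B - 1)] vanishes because [C^T C (P B - 1) = B (B P B - B) = 0], whence
   [D^T D = 0]. *)
have CPB : C *m (P *m B) = C.
  apply/eqP; rewrite -subr_eq0; set D := _ - _.
  have DD : D^T *m D = 0.
    have -> : D = C *m (P *m B - 1%:M) by rewrite mulmxBr mulmx1.
    rewrite trmx_mul mulmxA -(mulmxA _ C^T) -BB -!mulmxA.
    by rewrite (mulmxBr B) mulmx1 (mulmxA B P) BPB subrr !mulmx0.
  have DT0 : D^T = 0 by apply: mulmx_tr_eq0; rewrite trmxK.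
  by rewrite -(trmxK D) DT0 trmx0.
have -> : C *m C^T = C *m P *m C^T *m (C *m P *m C^T).
  have BPC : B *m P *m C^T = C^T.
    by have /(congr1 trmx) := CPB; rewrite !trmx_mul Bpsd.1 Ppsd.1.
  rewrite !mulmxA -(mulmxA _ C^T) -BB !mulmxA -(mulmxA C P B) CPB.
  by rewrite -[RHS]mulmxA -[RHS]mulmxA (mulmxA B) BPC.
rewrite psdsqrtmx_eq; last by rewrite -{1}[C]trmxK; exact: psdmx_congr.
by rewrite mxtrace_mulC mulmxA -BB -mulmxA -PB mulmxA BPB.
Qed.

(** * Maximising a trace over matrices with orthonormal columns *)

(** For [d > 0], expand the squared norm of [d v - t] and divide by [2 d]; for [d = 0] the vector
    [t] is zero. *)
Lemma row_cauchy_schwarz (R : realFieldType) (n : nat) (v t : 'rV[R]_n) (d : R) :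
  0 <= d -> v *m v^T = 1%:M -> (t *m t^T) 0 0 = d ^+ 2 -> (v *m t^T) 0 0 <= d.
Proof.
rewrite le_eqVlt => /orP[/eqP <- _ /eqP|d0 vv tt].
  by rewrite expr0n row_sqrnorm_eq0 => /eqP ->; rewrite trmx0 mulmx0 mxE.
have := row_sqrnorm_ge0 (d *: v - t).
have tv : (t *m v^T) 0 0 = (v *m t^T) 0 0.
  by rewrite -[t *m _]trmxK trmx_mul trmxK mxE.
rewrite linearB linearZ /= mulmxBr !mulmxBl -!scalemxAl -!scalemxAr vv.
move: tv tt; set vt := v *m t^T; set tv := t *m v^T; set tt := t *m t^T.
rewrite !mxE eqxx => -> -> h.
by rewrite -(ler_pM2l d0); move: h; rewrite mulr1; lra.
Qed.

(** Diagonalising [B] makes the rows of [Q Y^T] orthogonal with norms [d_i], since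
    [Q Y^T Y Q^T = Q B^2 Q^T]. Both the trace bound and its attainment start from this. *)
Lemma psdmx_sqrt_diag_gram (R : realType) (k n : nat) (Y : 'M[R]_(n, k)) (B : 'M[R]_k) :
  psdmx B -> B *m B = Y^T *m Y ->
  exists (Q : 'M[R]_k) (d : 'rV[R]_k),
    [/\ Q *m Q^T = 1%:M, forall i, 0 <= d 0 i, \tr B = \sum_i d 0 i
      & Q *m Y^T *m (Q *m Y^T)^T = diag_mx (\row_i d 0 i ^+ 2)].
Proof.
move=> Bpsd BB; have [Q [d [QQ d0 BE]]] := psdmx_spectral Bpsd.
exists Q, d; split=> //.
  by rewrite BE mxtrace_mulC mulmxA QQ mul1mx mxtrace_diag.
rewrite trmx_mul trmxK mulmxA -(mulmxA Q) -BB BE !mulmxA QQ mul1mx.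
rewrite -(mulmxA _ Q Q^T) QQ mulmx1 -(mulmxA _ Q Q^T) QQ mulmx1 mulmx_diag.
by congr diag_mx; apply/rowP => i; rewrite !mxE.
Qed.

(** The trace of [B] is the nuclear norm of [Y]. The trace on the left is a sum of inner products of
    the orthonormal rows of [Q W^T] with the rows of [Q Y^T], each at most [d_i]. *)
Lemma mxtrace_le_psdsqrt (R : realType) (k n : nat) (Y W : 'M[R]_(n, k)) (B : 'M[R]_k) :
  psdmx B -> B *m B = Y^T *m Y -> W^T *m W = 1%:M -> \tr (W^T *m Y) <= \tr B.
Proof.
move=> Bpsd BB WW; have [Q [d [QQ d0 -> TT]]] := psdmx_sqrt_diag_gram Bpsd BB.
have -> : \tr (W^T *m Y) = \tr (Q *m W^T *m (Q *m Y^T)^T).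
  by rewrite trmx_mul trmxK -mulmxA [RHS]mxtrace_mulC -!mulmxA (mulmx1C QQ) mulmx1.
apply: ler_sum => i _; rewrite mulmx_row_trmx; apply: row_cauchy_schwarz => //.
  have VV : Q *m W^T *m (Q *m W^T)^T = 1%:M.
    by rewrite trmx_mul trmxK mulmxA -(mulmxA Q) WW mulmx1.
  by apply/matrixP => a b; rewrite !ord1 -mulmx_row_trmx VV !mxE !eqxx.
by rewrite -mulmx_row_trmx TT !mxE eqxx.
Qed.

(** The maximiser is a polar factor of [Y], that is, [Y = W B], chosen orthogonal to [e] even where
    [B] is singular. *)
Lemma mxtrace_eq_psdsqrt (R : realType) (k n : nat) (Y : 'M[R]_(n, k)) (B : 'M[R]_k)
    (e : 'rV[R]_n) : (k < n)%N -> e *m Y = 0 -> psdmx B -> B *m B = Y^T *m Y ->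
  exists W : 'M[R]_(n, k), [/\ W^T *m W = 1%:M, e *m W = 0 & \tr (W^T *m Y) = \tr B].
Proof.
move=> ltkn eY Bpsd BB; have [Q [d [QQ d0 trB TT]]] := psdmx_sqrt_diag_gram Bpsd BB.
set T := Q *m Y^T in TT.
have Te : T *m e^T = 0 by rewrite -mulmxA -trmx_mul eY trmx0 mulmx0.
have YE : Y = T^T *m Q by rewrite trmx_mul trmxK -mulmxA (mulmx1C QQ) mulmx1.
have TTij i j : (T *m T^T) i j = d 0 i ^+ 2 *+ (i == j) by rewrite TT !mxE.
move: T YE Te TTij {TT} => T -> Te TTij.
pose D := diag_mx (map_mx GRing.inv d).
have DGD (G : 'M_k) i j : (D *m G *m D) i j = (d 0 i)^-1 * G i j / d 0 j.
  by rewrite mul_diag_mx mul_mx_diag !mxE.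
have rowD i : row i (D *m T) = (d 0 i)^-1 *: row i T.
  by apply/rowP => j; rewrite mul_diag_mx !mxE.
(* Only the rows with [d_i] nonzero can be normalised; the completion supplies the others. *)
have [||V [VV Ve VT]] :=
    @orthonormal_completion _ k n e [set i | d 0 i != 0]%SET (D *m T) ltkn.
- by move=> i _; rewrite -mulmxA Te mulmx0 mxE.
- move=> i j; rewrite !inE => di dj.
  rewrite trmx_mul tr_diag_mx mulmxA -(mulmxA D) DGD TTij.
  have [<-|_] := eqVneq i j.
    by rewrite !mulr1n; field.
  by rewrite mulr0 mul0r.
exists (V^T *m Q); split.
- by rewrite trmx_mul trmxK mulmxA -(mulmxA _ V) VV mulmx1 (mulmx1C QQ).
- by rewrite mulmxA -[e *m _]trmxK trmx_mul trmxK Ve trmx0 mul0mx.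
rewrite trB trmx_mul trmxK mxtrace_mulC -mulmxA (mulmxA Q) QQ mul1mx mxtrace_mulC.
(* If [d_i = 0], the row of [T] is zero, so the row chosen by the completion contributes 0. *)
apply: eq_bigr => i _; rewrite mulmx_row_trmx; have [di|di] := eqVneq (d 0 i) 0.
  have /eqP : (row i T *m (row i T)^T) 0 0 = 0.
    by rewrite -mulmx_row_trmx TTij di expr0n mul0rn.
  by rewrite row_sqrnorm_eq0 => /eqP ->; rewrite trmx0 mulmx0 mxE di.
rewrite VT ?inE // rowD -scalemxAl mxE -mulmx_row_trmx TTij eqxx mulr1n.
by field.
Qed.

(** * The loss as a trace, and its minimum *)

Lemma frobnorm_sqr (R : realType) (k l : nat) (A : 'M[R]_(k, l)) :
  frobnorm A ^+ 2 = \tr (A^T *m A).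
Proof.
rewrite sqr_sqrtr; last by do 2![rewrite sumr_ge0 // => ? _]; rewrite sqr_ge0.
rewrite exchange_big; apply: eq_bigr => j _; rewrite mxE.
by apply: eq_bigr => i _; rewrite mxE.
Qed.

(** The five block conditions become two conditions on the whole of [Z]; positivity of [n] lets the
    factor [1/n] be removed from the off-diagonal block. *)
Lemma ThetaZP (R : realType) (n m p : nat) (Z : 'M[R]_(n, m + p)) : (0 < n)%N ->
  ThetaZ Z <-> (const_mx 1 : 'cV[R]_n)^T *m Z = 0 /\ n%:R^-1 *: (Z^T *m Z) = 1%:M.
Proof.
move=> n0; have n1 : n%:R^-1 != 0 :> R by rewrite invr_eq0 pnatr_eq0 -lt0n.
have blockE (F : 'M[R]_(n, m)) (E : 'M[R]_(n, p)) :
    n%:R^-1 *: ((row_mx F E)^T *m row_mx F E) = block_mx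
      (n%:R^-1 *: (F^T *m F)) (n%:R^-1 *: (F^T *m E))
      (n%:R^-1 *: (E^T *m F)) (n%:R^-1 *: (E^T *m E)).
  by rewrite tr_row_mx mul_col_row scale_block_mx.
split=> [[F [E [-> [eF eE FF EE FE]]]]|].
  rewrite mul_mx_row eF eE row_mx0 blockE FF EE FE -[E^T *m F]trmxK trmx_mul trmxK FE.
  by rewrite trmx0 !scaler0 -scalar_mx_block.
rewrite -[Z]hsubmxK mul_mx_row blockE scalar_mx_block.
move=> [/eqP]; rewrite row_mx_eq0 => /andP[/eqP eF /eqP eE] /eq_block_mx[FF /eqP FE _ EE].
exists (lsubmx Z), (rsubmx Z); split=> //; split=> //.
by move: FE; rewrite scaler_eq0 (negbTE n1) => /eqP.
Qed.

(** The term quadratic in [Z] is constant under the constraint, so minimising the loss amounts to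
    maximising a linear trace. *)
Lemma mdfa_lossE (R : realType) (n m p : nat) (X : 'M[R]_(n, p))
    (Phi : 'M[R]_(p, m + p)) (Z : 'M[R]_(n, m + p)) :
  n%:R^-1 *: (Z^T *m Z) = 1%:M ->
  mdfa_loss X Phi Z = \tr (sample_cov X) + \tr (Phi *m Phi^T)
    - 2 * (n%:R^-1 * \tr (Z^T *m (X *m Phi))).
Proof.
move=> ZZ; rewrite /mdfa_loss /sample_cov frobnorm_sqr.
have ZZ' : n%:R^-1 * \tr (Phi *m Z^T *m (Z *m Phi^T)) = \tr (Phi *m Phi^T).
  by rewrite mulmxA -(mulmxA _ Z^T) -mxtraceZ scalemxAl scalemxAr ZZ mulmx1.
rewrite mxtraceZ [(X - _)^T]linearB /= trmx_mul trmxK mulmxBr !mulmxBl !linearB /= -ZZ'.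
have -> : \tr (X^T *m (Z *m Phi^T)) = \tr (Z^T *m (X *m Phi)).
  by rewrite -mxtrace_tr !trmx_mul !trmxK -mulmxA mxtrace_mulC mulmxA.
have -> : \tr (Phi *m Z^T *m X) = \tr (Z^T *m (X *m Phi)).
  by rewrite -mulmxA mxtrace_mulC mulmxA.
by ring.
Qed.

Lemma inf_attained (R : realType) (A : set R) (x : R) :
  A x -> lbound A x -> inf A = x.
Proof.
move=> Ax lAx; apply/eqP; rewrite eq_le; apply/andP; split.
  by apply: ge_inf => //; exists x.
by apply: lb_le_inf => //; exists x.
Qed.

Theorem proposition3p1 (R : realType) (p m n : nat)
    (p_gt0 : (0 < p)%N) (m_gt0 : (0 < m)%N) (n_gt0 : (0 < n)%N)
    (ltmp : (m < p)%N) (ltmpn : (m + p < n)%N)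
    (cLambda cL cU : R)
    (cLambda_gt0 : 0 < cLambda) (cL_gt0 : 0 < cL) (lecLU : cL <= cU)
    (X : 'M[R]_(n, p)) (X_centered : (const_mx 1 : 'cV[R]_n)^T *m X = 0)
    (Phi : 'M[R]_(p, m + p)) (PhiP : ThetaPhi cLambda cL cU Phi) :
  let S := sample_cov X in
  [/\ mdfa_losses X Phi (mdfa_min_loss X Phi)
        /\ lbound (mdfa_losses X Phi) (mdfa_min_loss X Phi),
      mdfa_min_loss X Phi =
        \tr S + \tr (Phi *m Phi^T) - 2 * \tr (psdsqrtmx (Phi^T *m S *m Phi)),
      \tr S + \tr (Phi *m Phi^T) - 2 * \tr (psdsqrtmx (Phi^T *m S *m Phi)) =
        \tr S + \tr (Sigma Phi)
        - 2 * \tr (psdsqrtmx (psdsqrtmx S *m Sigma Phi *m psdsqrtmx S))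
    & \tr S + \tr (Sigma Phi)
        - 2 * \tr (psdsqrtmx (psdsqrtmx S *m Sigma Phi *m psdsqrtmx S)) =
      dBW S (Sigma Phi) ^+ 2].
Proof.
move=> S.
set e := (const_mx 1)^T in X_centered.
have ngt0 : 0 < n%:R :> R by rewrite ltr0n.
(* The factor [1/n] is split into two factors [1/r], one for [Y] and one for [Z]. *)
pose r : R := Num.sqrt n%:R.
have r0 : r != 0 by rewrite gt_eqF ?sqrtr_gt0.
have rr : n%:R^-1 = r^-1 * r^-1 by rewrite -invfM -expr2 sqr_sqrtr ?ltW.
pose Y := r^-1 *: (X *m Phi).
have YY : Y^T *m Y = Phi^T *m S *m Phi.
  rewrite /Y [(_ *: _)^T]linearZ /= -scalemxAl -scalemxAr scalerA -rr trmx_mul.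
  by rewrite -scalemxAr -scalemxAl !mulmxA.
have Spsd : psdmx S.
  rewrite /S /sample_cov rr -scalerA scalemxAr scalemxAl.
  by have := psdmx_gram (r^-1 *: X); rewrite [(_ *: _)^T]linearZ.
have [] := psdsqrtmxP (psdmx_gram Y); set B := psdsqrtmx _ => Bpsd BB.
set L := \tr S + \tr (Phi *m Phi^T) - 2 * \tr (psdsqrtmx (Phi^T *m S *m Phi)).
have LE : L = \tr S + \tr (Phi *m Phi^T) - 2 * \tr B by rewrite /L -YY.
have L_attained : mdfa_losses X Phi L.
  (* Centering of [X] makes [Y] orthogonal to the vector of ones, as the attainment result requires;
     the minimiser is then [r *: W]. *)
  have eY : e *m Y = 0 by rewrite -scalemxAr mulmxA X_centered mul0mx scaler0.
  have [W [WW eW trW]] := mxtrace_eq_psdsqrt ltmpn eY Bpsd BB.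
  have rWW : n%:R^-1 *: ((r *: W)^T *m (r *: W)) = 1%:M.
    rewrite [(_ *: _)^T]linearZ /= -scalemxAl -scalemxAr WW !scalerA rr divfK //.
    by rewrite mulVf // scale1r.
  exists (r *: W).
    by apply/(ThetaZP _ n_gt0); split; rewrite // -scalemxAr eW scaler0.
  rewrite mdfa_lossE // LE -trW [(_ *: _)^T]linearZ /= -scalemxAl -scalemxAr !mxtraceZ rr.
  by congr (_ - 2 * _); field.
have L_lbound : lbound (mdfa_losses X Phi) L.
  move=> _ [Z /(ThetaZP _ n_gt0)[eZ ZZ] <-].
  rewrite mdfa_lossE // LE lerB // ler_pM2l //.
  have := @mxtrace_le_psdsqrt _ _ _ Y (r^-1 *: Z) B Bpsd BB.
  rewrite [(_ *: _)^T]linearZ /= -!scalemxAl -!scalemxAr !scalerA -rr ZZ mxtraceZ; exact.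
have minE : mdfa_min_loss X Phi = L by exact: inf_attained.
have sqrtE : \tr (psdsqrtmx (Phi^T *m S *m Phi)) =
    \tr (psdsqrtmx (psdsqrtmx S *m Sigma Phi *m psdsqrtmx S)).
  have [[Ssym _] SS] := psdsqrtmxP Spsd.
  (* Both matrices under the roots are Gram products of [C = S^(1/2) Phi], taken in the two
     orders. *)
  have -> : Phi^T *m S *m Phi = (psdsqrtmx S *m Phi)^T *m (psdsqrtmx S *m Phi).
    by rewrite -{1}SS trmx_mul Ssym !mulmxA.
  by rewrite mxtrace_psdsqrt_gram_tr trmx_mul Ssym !mulmxA.
split; rewrite ?minE //; first by rewrite /L sqrtE.
(* Squaring undoes the root in [dBW] only for a nonnegative radicand; here it is [L], an attained
   loss and hence nonnegative. *)
rewrite sqr_sqrtr // -sqrtE -/L.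
by case: L_attained => Z _ <-; rewrite mulr_ge0 ?sqr_ge0 // invr_ge0 ltW.
Qed.
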